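(* Let $\{(\alpha_t,m_t,v_t)\}_{t=1}^T$ be the output of Algorithm A (see context) applied to the equation $$\mathbf{e}^\top\bm\Sigma_{sa}^{-2}\big[-\bm b\alpha+\gamma\mathbf{e}+2\bm\Sigma_{sa}^2\overline{\bm p}_{sa}\big]_+=2,\qquad(\mathrm{E1})$$ so that the solution path $\gamma^1$ of (E1) satisfies $\gamma^1(\alpha)=m_t\alpha+v_t$ for $\alpha\in[\alpha_t,\alpha_{t-1}]$, $t=1,\dots,T$, with $\alpha_0=\infty$ and $\alpha_T=-\infty$. Let $\beta$ be fixed. Then Algorithm B (see context) computes a value $\alpha^\star\ge 0$ such that $(\alpha^\star,\gamma^\star)$ with $\gamma^\star=\gamma^1(\alpha^\star)$ satisfies the system consisting of (E1) and $$\bm b^\top\bm\Sigma_{sa}^{-2}\big[-\bm b\alpha+\gamma\mathbf{e}+2\bm\Sigma_{sa}^2\overline{\bm p}_{sa}\big]_+=2\beta.\qquad(\mathrm{E2})$$ Moreover, Algorithm B runs in time $\mathcal{O}(ST)$; since $T\le 2S$, the overall time is $\mathcal{O}(S^2)$.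
   Context: Let $\mathcal{S}=\{1,\dots,S\}$, $\overline{\bm p}_{sa}\in\Delta_S=\{\bm p\in\mathbb{R}^S_+:\mathbf{e}^\top\bm p=1\}$, $\bm\sigma_{sa}=(\sigma_{sas'})_{s'\in\mathcal{S}}>\bm 0$ component-wise, $\bm\Sigma_{sa}=\mathrm{diag}(\bm\sigma_{sa})$, $\bm b\in\mathbb{R}^S_+$ and $\beta\in\mathbb{R}_+$ with $\min_i b_i\le\beta<\bm b^\top\overline{\bm p}_{sa}$. $\mathbf{e}$ is the all-ones vector and $[\cdot]_+$ is the component-wise positive part. Equation (E1) has the generic form $\bm a^\top[-\bm b\alpha+\gamma\mathbf{e}+\bm c]_+=\rho$ with $a_{s'}=\sigma_{sas'}^{-2}$, $c_{s'}=2\sigma_{sas'}^2\overline p_{sas'}$ and $\rho=2$. Regularity assumption on $(\bm a,\bm b,\bm c,\rho)$: (i) $b_s\ne b_t$ for all $s\ne t$; (ii) $\rho+\sum_{s'\in\mathcal{S}'}a_{s'}(-c_{s'}+c_s)\ne0$ for all $\mathcal{S}'\subseteq\mathcal{S}$ and $s\in\mathcal{S}$; (iii) $\rho+\sum_{s'\in\mathcal{S}'}a_{s'}(b_{s'}-b_s)(\alpha_{s,t}-\alpha_{s,s'})\ne0$ for all $\mathcal{S}'\subseteq\mathcal{S}$ and $s\ne t$ in $\mathcal{S}$, where $\alpha_{i,j}=(c_i-c_j)/(b_i-b_j)$ and the summand for $s'=s$ is read as $0$. Algorithm A (input $\bm a>\bm 0$, $\bm b,\bm c\ge\bm 0$,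 $\rho>0$). Relabel indices so that $b_1<\dots<b_S$. Set $\mathcal{I}_1=\{1\}$ and $\alpha_0=\infty$. For $t=1,2,\dots$: let $\gamma_t(\alpha)=\frac{\rho+\sum_{s\in\mathcal{I}_t}a_s(b_s\alpha-c_s)}{\sum_{s\in\mathcal{I}_t}a_s}=:m_t\alpha+v_t$; let $\alpha_t$ be the largest real $\alpha<\alpha_{t-1}$ such that $-b_s\alpha+\gamma_t(\alpha)+c_s=0$ for some $s\in\mathcal{S}$, with $\alpha_t=-\infty$ if there is none. If $\alpha_t>-\infty$, let $s_t$ be the index with $-b_{s_t}\alpha_t+\gamma_t(\alpha_t)+c_{s_t}=0$ and set $\mathcal{I}_{t+1}=\mathcal{I}_t\setminus\{s_t\}$ if $s_t\in\mathcal{I}_t$ and $\mathcal{I}_{t+1}=\mathcal{I}_t\cup\{s_t\}$ otherwise; if $\alpha_t=-\infty$, set $T=t$ and stop. Output: $(\alpha_t,m_t,v_t)$, $t=1,\dots,T$. Algorithm B (input: the output of Algorithm A for (E1), and $\bm b,\bm\Sigma_{sa},\overline{\bm p}_{sa},\beta$). For $t=1,\dots,T$ (segments with $\alpha_{t-1}\le0$ are skipped): choose an interior point $\tilde\alpha_t\in(\alpha_t,\alpha_{t-1})\cap\mathbb{R}_+$; compute $\hat{\mathcal{S}}_t=\{s'\in\mathcal{S}:(m_t-b_{s'})\tilde\alpha_t+(v_t+2\sigma_{sas'}^2\overline p_{sas'})>0\}$; compute $A_t=\sum_{s'\in\hat{\mathcal{S}}_t}\frac{b_{s'}}{\sigma_{sas'}^2}(m_t-b_{s'})$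 and $B_t=\sum_{s'\in\hat{\mathcal{S}}_t}\frac{b_{s'}}{\sigma_{sas'}^2}(v_t+2\sigma_{sas'}^2\overline p_{sas'})$; let $F_t(\alpha)=A_t\alpha+B_t$, $y_{\rm low}=F_t(\max\{0,\alpha_t\})$ and $y_{\rm high}=F_t(\alpha_{t-1})$ (the limit if $\alpha_{t-1}=\infty$). If $\min\{y_{\rm low},y_{\rm high}\}\le2\beta\le\max\{y_{\rm low},y_{\rm high}\}$, then set $\alpha^\star=\max\{0,\alpha_t\}$ if $A_t=0$ and $\alpha^\star=(2\beta-B_t)/A_t$ if $A_t\ne0$, set $\gamma^\star=m_t\alpha^\star+v_t$, and return $(\alpha^\star,\gamma^\star)$. Time counts elementary arithmetic operations. *)

(* Defs.v *)
From HB Require Import structures.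
From mathcomp Require Import all_boot all_order all_algebra.
From mathcomp Require Import reals constructive_ereal.

Set Implicit Arguments.
Unset Strict Implicit.
Unset Printing Implicit Defensive.

Import Order.TTheory GRing.Theory Num.Theory.
Local Open Scope ring_scope.

(* Running time is counted in a writer monad: a timed computation is a value
   together with the number of elementary operations used to obtain it.  Every
   arithmetic operation, comparison, minimum or maximum on (extended) real
   numbers is wrapped in one [op] and costs 1; moving data around (lists of
   indices, branching on an already computed boolean) is free. *)
Definition timed (X : Type) : Type := (X * nat)%type.
Definition ret (X : Type) (x : X) : timed X := (x, 0%N).
Definition op (X : Type) (x : X) : timed X := (x, 1%N).
Definition bind (X Y : Type) (u : timed X) (f : X -> timed Y) : timed Y :=
  ((f u.1).1, (u.2 + (f u.1).2)%N).

Notation "'let*' x := u 'in' w" := (bind u (fun x => w))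
  (at level 200, x name, u at level 200, w at level 200,
   format "'[v' 'let*'  x  :=  u  'in' '/' w ']'").

Section Loops.
Variables (R : realType) (I : Type).

Definition sumT (r : seq I) (f : I -> timed R) : timed R :=
  foldr (fun i acc =>
    let* y := f i in
    let* x := acc in
    op (y + x)) (ret 0) r.

Definition filterT (r : seq I) (test : I -> timed bool) : timed (seq I) :=
  foldr (fun i acc =>
    let* h := test i in
    let* l := acc in
    ret (if h then i :: l else l)) (ret [::]) r.

End Loops.

Section Equation.
Variables (R : realType) (S : nat).
Implicit Types (w a b c sigma pbar : 'I_S -> R) (alpha gamma rho beta : R).

Definition simplex pbar : Prop :=
  (forall s, 0 <= pbar s) /\ \sum_s pbar s = 1.

(* w^T [- b alpha + gamma e + c]_+ *)
Definition pos_form w b c alpha gamma : R :=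
  \sum_s w s * Num.max 0 (- b s * alpha + gamma + c s).

Definition inv_var sigma (s : 'I_S) : R := sigma s ^- 2.

Definition shift sigma pbar (s : 'I_S) : R := 2 * sigma s ^+ 2 * pbar s.

Definition E1 sigma pbar b alpha gamma : Prop :=
  pos_form (inv_var sigma) b (shift sigma pbar) alpha gamma = 2.

Definition E2 sigma pbar b beta alpha gamma : Prop :=
  pos_form (fun s => b s * inv_var sigma s) b (shift sigma pbar) alpha gamma
  = 2 * beta.

Definition solution_path sigma pbar b (gamma1 : R -> R) : Prop :=
  forall alpha gamma, E1 sigma pbar b alpha gamma <-> gamma = gamma1 alpha.

Definition crossing b c (i j : 'I_S) : R := (c i - c j) / (b i - b j).

Definition regular a b c rho : Prop :=
  [/\ forall s t, s != t -> b s != b t,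
      forall (A : {set 'I_S}) (s : 'I_S),
        rho + \sum_(s' in A) a s' * (- c s' + c s) != 0
    & forall (A : {set 'I_S}) (s t : 'I_S), s != t ->
        rho + \sum_(s' in A | s' != s)
                a s' * (b s' - b s) * (crossing b c s t - crossing b c s s')
        != 0].

End Equation.

(* The list of triples (alpha_t, m_t, v_t), t = 1, ..., T, so that T is the
   size of the list.  Positions in the list start at 0. *)
Definition segments (R : realType) : Type := seq (\bar R * R * R).

Section Segments.
Variables (R : realType) (out : segments R).

Definition seg (t : nat) : \bar R * R * R := nth (-oo%E, 0, 0) out t.-1.

Definition seg_alpha (t : nat) : \bar R :=
  if t is 0%N then +oo%E else (seg t).1.1.
Definition seg_m (t : nat) : R := (seg t).1.2.
Definition seg_v (t : nat) : R := (seg t).2.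

End Segments.

Section AlgorithmA.
Variables (R : realType) (S : nat) (a b c : 'I_S -> R) (rho : R).
Implicit Types (I : {set 'I_S}) (s : 'I_S) (prev : \bar R).

Definition gamma_seg I (alpha : R) : R :=
  (rho + \sum_(s in I) a s * (b s * alpha - c s)) / \sum_(s in I) a s.

Definition slope I : R := (\sum_(s in I) a s * b s) / \sum_(s in I) a s.
Definition intercept I : R :=
  (rho - \sum_(s in I) a s * c s) / \sum_(s in I) a s.

Definition zero_at I s (alpha : R) : Prop :=
  - b s * alpha + gamma_seg I alpha + c s = 0.

Definition toggle I s : {set 'I_S} := if s \in I then I :\ s else s |: I.

(* [runA prev I out]: the iterations of the algorithm from the state with
   alpha_{t-1} = prev and I_t = I until it stops append out to the output. *)
Inductive runA prev I : segments R -> Prop :=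
| runA_stop :
    (forall (alpha : R) s, (alpha%:E < prev)%E -> ~ zero_at I s alpha) ->
    runA prev I [:: (-oo%E, slope I, intercept I)]
| runA_step (alpha : R) s out :
    (alpha%:E < prev)%E -> zero_at I s alpha ->
    (forall (alpha' : R) s', (alpha'%:E < prev)%E -> zero_at I s' alpha' ->
       alpha' <= alpha) ->
    runA alpha%:E (toggle I s) out ->
    runA prev I ((alpha%:E, slope I, intercept I) :: out).

(* Relabelling the indices by increasing b only serves to identify index 1,
   which is the index of the smallest entry of b. *)
Definition outputA (out : segments R) : Prop :=
  exists2 i : 'I_S, (forall j, b i <= b j) & runA +oo%E [set i] out.

(* A timed implementation of the same algorithm.  [algA N] gives up, and
   returns None, if it has not stopped after N iterations. *)
Definition min_indexT : timed (option 'I_S) :=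
  foldr (fun s acc =>
    let* best := acc in
    if best is Some i then
      let* lt := op (b s < b i) in
      ret (Some (if lt then s else i))
    else ret (Some s)) (ret None) (enum 'I_S).

Definition slopeT I : timed R :=
  let* n := sumT (enum I) (fun s => op (a s * b s)) in
  let* d := sumT (enum I) (fun s => ret (a s)) in
  op (n / d).

Definition interceptT I : timed R :=
  let* n := sumT (enum I) (fun s => op (a s * c s)) in
  let* d := sumT (enum I) (fun s => ret (a s)) in
  let* n' := op (rho - n) in
  op (n' / d).

Definition next_zeroT prev (m v : R) : timed (option (R * 'I_S)) :=
  foldr (fun s acc =>
    let* best := acc in
    let* d := op (m - b s) in
    let* parallel := op (d == 0) in
    if parallel then ret best else
    let* n := op (v + c s) in
    let* q := op (n / d) in
    let* x := op (- q) in
    let* below := op (x%:E < prev)%E in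
    if below then
      if best is Some y then
        let* larger := op (y.1 < x) in
        ret (if larger then Some (x, s) else Some y)
      else ret (Some (x, s))
    else ret best) (ret None) (enum 'I_S).

Fixpoint loopA (N : nat) prev I : timed (option (segments R)) :=
  if N is N'.+1 then
    let* m := slopeT I in
    let* v := interceptT I in
    let* next := next_zeroT prev m v in
    if next is Some (alpha, s) then
      let* out := loopA N' alpha%:E (toggle I s) in
      ret (omap (cons (alpha%:E, m, v)) out)
    else ret (Some [:: (-oo%E, m, v)])
  else ret None.

Definition algA (N : nat) : timed (option (segments R)) :=
  let* first := min_indexT in
  if first is Some i then loopA N +oo%E [set i] else ret None.

End AlgorithmA.

Section AlgorithmB.
Variables (R : realType) (S : nat).

(* The choice of the interior points is left open: any rule that, in constant
   time k, picks a nonnegative point of a nonempty interval ]lo, hi[ with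
   hi > 0 may be used. *)
Definition interior_rule (k : nat) (pick : \bar R -> \bar R -> timed R)
    : Prop :=
  forall lo hi : \bar R, (lo < hi)%E -> (0%:E < hi)%E ->
    [/\ (lo < (pick lo hi).1%:E)%E, ((pick lo hi).1%:E < hi)%E,
        0 <= (pick lo hi).1 & ((pick lo hi).2 <= k)%N].

Variables (sigma pbar b : 'I_S -> R) (beta : R).
Variable pick : \bar R -> \bar R -> timed R.

Definition shiftT (s : 'I_S) : timed R :=
  let* q := op (sigma s * sigma s) in
  let* d := op (2 * q) in
  op (d * pbar s).

Definition ratioT (s : 'I_S) : timed R :=
  let* q := op (sigma s * sigma s) in
  op (b s / q).

Definition activeT (m v x : R) : timed (seq 'I_S) :=
  filterT (enum 'I_S) (fun s =>
    let* d := op (m - b s) in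
    let* y := op (d * x) in
    let* c := shiftT s in
    let* w := op (v + c) in
    let* h := op (y + w) in
    op (0 < h)).

Definition coefAT (m : R) (act : seq 'I_S) : timed R :=
  sumT act (fun s =>
    let* r := ratioT s in
    let* d := op (m - b s) in
    op (r * d)).

Definition coefBT (v : R) (act : seq 'I_S) : timed R :=
  sumT act (fun s =>
    let* r := ratioT s in
    let* c := shiftT s in
    let* w := op (v + c) in
    op (r * w)).

(* F(x) = A x + B on extended reals; as 0 * +oo = 0 in \bar R, the value at
   x = +oo is the limit of F at +oo. *)
Definition affineT (A B : R) (x : \bar R) : timed (\bar R) :=
  let* y := op (A%:E * x)%E in
  op (y + B%:E)%E.

Fixpoint loopB (prev : \bar R) (out : segments R) : timed (option (R * R)) :=
  if out is (alpha, m, v) :: out' then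
    let* skip := op (prev <= 0%:E)%E in
    if skip then loopB alpha out' else
    let* x := pick alpha prev in
    let* act := activeT m v x in
    let* A := coefAT m act in
    let* B := coefBT v act in
    let* lo := op (Order.max 0%:E alpha) in
    let* ylow := affineT A B lo in
    let* yhigh := affineT A B prev in
    let* ymin := op (Order.min ylow yhigh) in
    let* ymax := op (Order.max ylow yhigh) in
    let* target := op (2 * beta) in
    let* above := op (ymin <= target%:E)%E in
    let* below := op (target%:E <= ymax)%E in
    if above && below then
      let* flat := op (A == 0) in
      let* alpha_star :=
        (if flat then ret (fine lo)
         else let* n := op (target - B) in op (n / A)) in
      let* g := op (m * alpha_star) in
      let* gamma_star := op (g + v) in
      ret (Some (alpha_star, gamma_star))
    else loopB alpha out'
  else ret None.

Definition algB (out : segments R) : timed (option (R * R)) := loopB +oo%E out.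

End AlgorithmB.

(* Main.v *)
Require Import Defs.
From mathcomp Require Import all_boot all_order all_algebra ring lra zify.
From mathcomp Require Import boolp reals constructive_ereal.

(** Write [l_s(x) = b s * x - c s].  Weighted by [a], the sum of the positive
    parts of [g - l_s(x)] is nondecreasing in [g], and strictly so wherever it
    is positive; hence for every [x] at most one [g] makes it equal to [rho]
    ([pos_form_inj]).  If [I] is the set of the indices whose line lies below
    [(x, g)], the equation is linear on [I], and solving it for [g] gives the
    affine function [gamma_seg I].  So the solution path is piecewise affine,
    and Algorithm A follows it from [+oo] downwards, changing [I] whenever the
    path meets one of the lines.

    The algorithm is analysed through [gap I s x = gamma_seg I x - l_s(x)].
    The one identity behind everything is [weight_gap]: [gap I s x] times the
    total weight of [I] is [rho] plus a sum over [I] whose term at [s] is zero.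
    It has two uses.  On the one hand, this expression does not change when [s]
    enters or leaves [I], so [gap I s] keeps its sign, and its slope keeps its
    sign; the new set is therefore the correct one just below the breakpoint
    ([active_before_toggle]).  On the other hand, the regularity conditions say
    exactly that this expression vanishes neither at [x = 0] nor for two
    indices at once ([gap_origin_neq0], [zero_unique]), so that no gap is
    identically zero and the index that toggles is determined.  This makes the
    output of Algorithm A unique, and [runA_path_ind] lets later arguments
    proceed segment by segment.

    The path is concave: its slope, an average of the [b s] over [I], increases
    at every breakpoint as [x] decreases.  An index [s] can enter only if
    [b s] exceeds the slope, and leaves only if [b s] is below it, hence it
    never comes back after it has left.  So each index toggles at most twice,
    and the starting index only once; [potential] counts the toggles that are
    still possible, and [T <= 2 * S] follows.

    Along the path the left-hand side of (E2) is continuous, and affine on each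
    segment.  Near [+oo] it is the constant [2 * b i], with [i] the starting
    index, hence at most [2 * beta].  At [x = 0] the path passes through
    [gamma = 0], because [pbar] has total mass one, and the left-hand side is
    [2 * \sum_s b s * pbar s], more than [2 * beta].  Algorithm B keeps the
    invariant that the value at the upper end of the current segment is at most
    [2 * beta]; so if a segment is rejected, the value at its lower end is
    still below [2 * beta], that end is positive, and the search must succeed
    before it reaches [0] ([loopB_segment], [loopB_correct]).  Each iteration of
    either algorithm costs [O(S)] operations. *)

Set Implicit Arguments.
Unset Strict Implicit.
Unset Printing Implicit Defensive.

Import Order.TTheory GRing.Theory Num.Theory.
Local Open Scope ring_scope.

(** * Values and costs of timed computations *)

Section Timed.

Lemma bind_val (X Y : Type) (u : timed X) (f : X -> timed Y) :
  (bind u f).1 = (f u.1).1.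
Proof. by []. Qed.

Lemma bind_cost (X Y : Type) (u : timed X) (f : X -> timed Y) :
  (bind u f).2 = (u.2 + (f u.1).2)%N.
Proof. by []. Qed.

Variables (R : realType) (I : Type).
Implicit Types (r : seq I) (k : nat).

Lemma sumT_val r (f : I -> timed R) : (sumT r f).1 = \sum_(i <- r) (f i).1.
Proof. by elim: r => [|i r IH]; rewrite ?big_nil ?big_cons //= IH. Qed.

Lemma sumT_cost r (f : I -> timed R) k :
  (forall i, (f i).2 <= k)%N -> ((sumT r f).2 <= size r * k.+1)%N.
Proof.
move=> f_le; elim: r => [|i r IH] //.
by rewrite /= mulSn; move: (f_le i) IH; rewrite /sumT; lia.
Qed.

Lemma filterT_val r (test : I -> timed bool) :
  (filterT r test).1 = [seq i <- r | (test i).1].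
Proof. by elim: r => [|i r IH] //=; rewrite IH. Qed.

Lemma filterT_cost r (test : I -> timed bool) k :
  (forall i, (test i).2 <= k)%N -> ((filterT r test).2 <= size r * k)%N.
Proof.
move=> test_le; elim: r => [|i r IH] //.
by rewrite /= mulSn; move: (test_le i) IH; rewrite /filterT; lia.
Qed.

End Timed.

(** * Signs of affine functions *)

Section Affine.
Variable R : realType.
Implicit Types (p q x y : R) (lo hi : \bar R).

(** An affine function that changes sign has its root [- q / p] strictly
    between the two points, hence in the open interval.  The weak inequality at
    the end points is what lets consecutive segments share a breakpoint. *)
Lemma affine_sign lo hi p q y :
  (lo < y%:E)%E -> (y%:E < hi)%E -> 0 < p * y + q ->
  (forall z, (lo < z%:E)%E -> (z%:E < hi)%E -> p * z + q <> 0) ->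
  forall x, ((lo <= x%:E)%E -> (x%:E <= hi)%E -> 0 <= p * x + q) /\
            ((lo < x%:E)%E -> (x%:E < hi)%E -> 0 < p * x + q).
Proof.
move=> loy yhi y_pos no_root x.
have weak : (lo <= x%:E)%E -> (x%:E <= hi)%E -> 0 <= p * x + q.
  move=> lox xhi; rewrite leNgt; apply/negP => x_neg.
  have p0 : p != 0 by apply/eqP => p0; move: x_neg y_pos; rewrite p0; lra.
  have rootE : p * (- q / p) + q = 0 by field.
  case: (ltgtP p 0) p0 => // p_sign _.
  - have yz : y < - q / p by rewrite ltr_ndivlMr //; lra.
    have zx : - q / p < x by rewrite ltr_ndivrMr //; lra.
    apply: (no_root (- q / p)) => //.
      by apply: lt_trans loy _; rewrite lte_fin.
    by apply: lt_le_trans xhi; rewrite lte_fin.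
  - have zy : - q / p < y by rewrite ltr_pdivrMr //; lra.
    have xz : x < - q / p by rewrite ltr_pdivlMr //; lra.
    apply: (no_root (- q / p)) => //.
      by apply: le_lt_trans lox _; rewrite lte_fin.
    by apply: lt_trans yhi; rewrite lte_fin.
split=> // lox xhi; rewrite lt_neqAle weak ?ltW // andbT eq_sym.
by apply/eqP; apply: no_root.
Qed.

Lemma affine_pos_left p q x :
  0 < p * x + q ->
  exists2 lo, lo < x & forall y, lo < y -> y < x -> 0 < p * y + q.
Proof.
move=> x_pos; have p1 : 0 < `|p| + 1 by rewrite ltr_wpDl.
(* Adding 1 to the modulus of the slope covers a constant function. *)
exists (x - (p * x + q) / (`|p| + 1)); first by rewrite gtrBl divr_gt0.
move=> y lo_y yx.
have : (x - y) * (`|p| + 1) < p * x + q by rewrite -ltr_pdivlMr //; lra.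
have : p * (x - y) <= `|p| * (x - y) by rewrite ler_wpM2r ?ler_norm //; lra.
by nra.
Qed.

Lemma real_between (lo hi : \bar R) : (lo < hi)%E ->
  exists y : R, (lo < y%:E)%E /\ (y%:E < hi)%E.
Proof.
case: lo hi => [lo| |] [hi| |] //; rewrite ?lte_fin.
- by move=> lh; exists ((lo + hi) / 2); rewrite !lte_fin; split; lra.
- by move=> _; exists (lo + 1); rewrite lte_fin ltry; split=> //; lra.
- by move=> _; exists (hi - 1); rewrite lte_fin ltNyr; split=> //; lra.
- by move=> _; exists 0; rewrite ltNyr ltry.
Qed.

End Affine.

(** * Active sets and the sectors where they are correct *)

Section SolutionPath.
Variables (R : realType) (S : nat) (a b c : 'I_S -> R) (rho : R).
Implicit Types (I : {set 'I_S}) (s : 'I_S) (prev lo hi : \bar R).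

Local Notation gamma := (gamma_seg a b c rho).
Local Notation zero_at := (zero_at a b c rho).
Local Notation slope := (slope a b).
Local Notation intercept := (intercept a c rho).

Definition weight I : R := \sum_(s in I) a s.

Definition gap I s (alpha : R) : R := - b s * alpha + gamma I alpha + c s.

(** The sign that [gap I s] must have for [I] to be the active set. *)
Definition side I s : R := (-1) ^+ (s \notin I).

(** For a nonempty [I], this makes [gamma_seg I] the solution path between [lo]
    and [hi]; only at the two ends may it meet one of the lines. *)
Definition sector I lo hi : Prop :=
  forall s (x : R),
    ((lo <= x%:E)%E -> (x%:E <= hi)%E -> 0 <= side I s * gap I s x) /\
    ((lo < x%:E)%E -> (x%:E < hi)%E -> 0 < side I s * gap I s x).

(** The invariant of Algorithm A.  Only the behaviour just below [prev] is
    fixed, by a bound [lo] that may depend on [s] and that is finite also for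
    [prev = +oo]; how far down [I] stays correct is left to the next zero. *)
Definition active_before prev I : Prop :=
  I != set0 /\
  forall s, exists2 lo : R, (lo%:E < prev)%E &
    forall x : R, lo < x -> (x%:E < prev)%E -> 0 < side I s * gap I s x.

Lemma gamma_segE I x : gamma I x = slope I * x + intercept I.
Proof.
rewrite /gamma_seg /Defs.slope /Defs.intercept mulrAC -mulrDl; congr (_ / _).
rewrite mulr_suml addrCA addrA -addrA; congr (_ + _).
rewrite -sumrB /=; apply: eq_bigr => s _; ring.
Qed.

Lemma gapE I s x : gap I s x = (slope I - b s) * x + (intercept I + c s).
Proof. by rewrite /gap gamma_segE; ring. Qed.

Lemma side_in I s : s \in I -> side I s = 1.
Proof. by rewrite /side => ->. Qed.

Lemma side_notin I s : s \notin I -> side I s = -1.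
Proof. by rewrite /side => ->. Qed.

Lemma set_neq0_gt0 I : I != set0 -> (0 < S)%N.
Proof. by case/set0Pn=> s _; apply: leq_ltn_trans (ltn_ord s). Qed.

Lemma in_toggle I s j : (j \in toggle I s) = (j == s) (+) (j \in I).
Proof.
rewrite /toggle; case: ifP => sI; rewrite !inE; case: eqVneq => // ->.
  by rewrite sI.
by rewrite sI.
Qed.

Lemma side_toggle I s : side (toggle I s) s = - side I s.
Proof.
rewrite /side in_toggle eqxx /=.
by case: (s \in I); rewrite ?expr0 ?expr1 ?opprK.
Qed.

Lemma side_toggle_neq I s j : j != s -> side (toggle I s) j = side I j.
Proof. by rewrite /side in_toggle => /negPf ->. Qed.

(** An index that contributes nothing may enter or leave freely. *)
Lemma sum_toggle I s (f : 'I_S -> R) :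
  f s = 0 -> \sum_(j in toggle I s) f j = \sum_(j in I) f j.
Proof.
move=> f0; rewrite [LHS]big_mkcond [RHS]big_mkcond; apply: eq_bigr => j _.
by rewrite in_toggle; case: eqVneq => [->|//]; rewrite f0 !if_same.
Qed.

Lemma sector_no_zero I lo hi s (x : R) :
  sector I lo hi -> (lo < x%:E)%E -> (x%:E < hi)%E -> gap I s x <> 0.
Proof.
move=> sec lo_x x_hi g0; have [_ /(_ lo_x x_hi)] := sec s x.
by rewrite g0 mulr0 ltxx.
Qed.

(** On a sector the positive parts drop the indices outside [I] and are
    inactive on [I]; the closed range suffices, as a zero gap contributes zero
    on either side. *)
Lemma pos_form_sector (w : 'I_S -> R) I lo hi (x : R) : sector I lo hi ->
  (lo <= x%:E)%E -> (x%:E <= hi)%E ->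
  pos_form w b c x (gamma I x) = \sum_(s in I) w s * gap I s x.
Proof.
move=> sec lo_x x_hi; rewrite [RHS]big_mkcond; apply: eq_bigr => s _.
have [/(_ lo_x x_hi) + _] := sec s x; rewrite -/(gap I s x).
have [sI|sI] := boolP (s \in I).
  by rewrite side_in // mul1r => /max_idPr ->.
rewrite side_notin // mulN1r oppr_ge0 => /max_idPl ->; exact: mulr0.
Qed.

(** [coefA w I] and [coefB w I] are the slope and the intercept on [I] of the
    [w]-weighted sum of positive parts along the path. *)
Definition coefA (w : 'I_S -> R) I : R := \sum_(s in I) w s * (slope I - b s).
Definition coefB (w : 'I_S -> R) I : R :=
  \sum_(s in I) w s * (intercept I + c s).

Lemma sum_gap_affine w I x :
  \sum_(s in I) w s * gap I s x = coefA w I * x + coefB w I.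
Proof.
rewrite /coefA mulr_suml -big_split; apply: eq_bigr => s _ /=.
by rewrite gapE mulrDr mulrA.
Qed.

Lemma pos_form_affine w I lo hi (x : R) : sector I lo hi ->
  (lo <= x%:E)%E -> (x%:E <= hi)%E ->
  pos_form w b c x (slope I * x + intercept I) = coefA w I * x + coefB w I.
Proof. by rewrite -gamma_segE -sum_gap_affine; apply: pos_form_sector. Qed.

(** * The timed subroutines of Algorithm A *)

Lemma size_enum_set I : (size (enum I) <= S)%N.
Proof. by rewrite -cardE -[leqRHS]card_ord max_card. Qed.

Lemma slopeT_val I : (slopeT a b I).1 = slope I.
Proof. by rewrite /slopeT /= !sumT_val /= !big_enum. Qed.

Lemma interceptT_val I : (interceptT a c rho I).1 = intercept I.
Proof. by rewrite /interceptT /= !sumT_val /= !big_enum. Qed.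

Lemma slopeT_cost I : ((slopeT a b I).2 <= 3 * S + 1)%N.
Proof.
have card_le := size_enum_set I.
rewrite /slopeT /=.
have num_le :=
  @sumT_cost _ _ (enum I) (fun s => op (a s * b s)) 1 (fun=> leqnn _).
have den_le := @sumT_cost _ _ (enum I) (fun s => ret (a s)) 0 (fun=> leqnn _).
by apply: leq_trans (leq_add num_le (leq_add den_le (leqnn _))) _; lia.
Qed.

Lemma interceptT_cost I : ((interceptT a c rho I).2 <= 3 * S + 2)%N.
Proof.
have card_le := size_enum_set I.
rewrite /interceptT /=.
have num_le :=
  @sumT_cost _ _ (enum I) (fun s => op (a s * c s)) 1 (fun=> leqnn _).
have den_le := @sumT_cost _ _ (enum I) (fun s => ret (a s)) 0 (fun=> leqnn _).
by apply: leq_trans (leq_add num_le (leq_add den_le (leqnn _))) _; lia.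
Qed.

Lemma loopA_step N prev I :
  let next := next_zeroT b c prev (slope I) (intercept I) in
  let t := ((slopeT a b I).2 + ((interceptT a c rho I).2 + next.2))%N in
  loopA a b c rho N.+1 prev I =
  if next.1 is Some (x, s) then
    let rest := loopA a b c rho N x%:E (toggle I s) in
    (omap (cons (x%:E, slope I, intercept I)) rest.1, t + rest.2)%N
  else (Some [:: (-oo%E, slope I, intercept I)], t).
Proof.
rewrite -slopeT_val -interceptT_val [loopA _ _ _ _ N.+1 _ _]/=.
case: (slopeT a b I) => m tm; case: (interceptT a c rho I) => v tv.
rewrite /bind [(m, tm).1]/= [(v, tv).1]/=.
case: (next_zeroT b c prev m v) => [[[x s]|] t] /=; last by rewrite addn0.
by rewrite addn0 !addnA.
Qed.

Lemma min_indexTP : (0 < S)%N ->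
  exists2 i, (min_indexT b).1 = Some i /\ (forall j, b i <= b j) &
    ((min_indexT b).2 <= S)%N.
Proof.
move=> S_gt0.
have [best_min t_le] :
    (if (min_indexT b).1 is Some i then forall j, j \in enum 'I_S -> b i <= b j
     else enum 'I_S = [::]) /\ ((min_indexT b).2 <= size (enum 'I_S))%N.
  rewrite /min_indexT; elim: (enum 'I_S) => [|s r] //=.
  set acc := foldr _ _ r; move: acc => [[i|] t] /= [IH t_le]; split; try by lia.
    move=> j; rewrite inE; case: ltP => [si|is_] /predU1P[->|/IH] //.
    by apply: le_trans; apply: ltW.
  by rewrite IH => j; rewrite inE => /eqP ->.
rewrite size_enum_ord in t_le.
case: (min_indexT b).1 best_min => [i i_min|/(congr1 size)].
  by exists i => //; split=> // j; apply: i_min; rewrite mem_enum.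
by rewrite size_enum_ord /=; lia.
Qed.

Definition largest_zero prev I (r : seq 'I_S) (best : option (R * 'I_S)) :=
  if best is Some (x, s) then
    [/\ (x%:E < prev)%E, zero_at I s x &
      forall (y : R) t, t \in r -> (y%:E < prev)%E -> zero_at I t y -> y <= x]
  else forall (y : R) t, t \in r -> (y%:E < prev)%E -> ~ zero_at I t y.

(** * Breakpoints *)

Hypothesis a_gt0 : forall s, 0 < a s.
Hypothesis rho_gt0 : 0 < rho.
Hypothesis reg : regular a b c rho.

Lemma weight_gt0 I : I != set0 -> 0 < weight I.
Proof.
case/set0Pn=> s sI; rewrite /weight (bigD1 s) //= ltr_pwDl //.
by apply: sumr_ge0 => j _; apply: ltW.
Qed.

Lemma weight_slope I s : I != set0 ->
  weight I * (slope I - b s) = \sum_(j in I) a j * (b j - b s).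
Proof.
move=> /weight_gt0 w_gt0.
rewrite mulrBr /Defs.slope mulrC divfK ?gt_eqF // mulr_suml -sumrB.
by apply: eq_bigr => j _; rewrite mulrBr.
Qed.

(** Relative to the line of [s], the right-hand side has no term at [s]: it is
    insensitive to whether [s] belongs to [I]. *)
Lemma weight_gap I s x : I != set0 ->
  weight I * gap I s x =
  rho + \sum_(j in I) a j * ((b j * x - c j) - (b s * x - c s)).
Proof.
move=> /weight_gt0 w_gt0.
have -> : gap I s x = gamma I x - (b s * x - c s) by rewrite /gap; ring.
rewrite mulrBr /gamma_seg mulrC divfK ?gt_eqF // mulr_suml -addrA -sumrB.
by congr (_ + _); apply: eq_bigr => j _; rewrite -mulrBr.
Qed.

Lemma sum_gap I x : I != set0 -> \sum_(s in I) a s * gap I s x = rho.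
Proof.
move=> /weight_gt0 w_gt0.
transitivity (weight I * gamma I x - \sum_(s in I) a s * (b s * x - c s)).
  by rewrite mulr_suml -sumrB; apply: eq_bigr => s _; rewrite /gap; ring.
by rewrite mulrC divfK ?gt_eqF // addrK.
Qed.

(** This excludes that a gap of zero slope vanishes identically. *)
Lemma gap_origin_neq0 I s : I != set0 -> gap I s 0 != 0.
Proof.
move=> I0; have [_ reg2 _] := reg; apply: contraNneq (reg2 I s) => g0.
apply/eqP; transitivity (weight I * gap I s 0); last by rewrite g0 mulr0.
rewrite weight_gap //.
by congr (_ + _); apply: eq_bigr => j _; congr (_ * _); ring.
Qed.

(** Two gaps that vanish at [x] make [x] the crossing of their two lines. *)
Lemma zero_unique I s t x :
  I != set0 -> gap I s x = 0 -> gap I t x = 0 -> s = t.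
Proof.
move=> I0 gs gt; have [reg1 _ reg3] := reg.
apply/eqP; apply: contraT => st; case/eqP: (reg3 I s t st).
have b_neq j k : j != k -> b j - b k != 0 by rewrite subr_eq0; apply: reg1.
have -> : crossing b c s t = x.
  rewrite /crossing; apply: (canLR (mulfK (b_neq _ _ st))).
  by move: gs gt; rewrite /gap; lra.
transitivity (weight I * gap I s x); last by rewrite gs mulr0.
rewrite weight_gap //; congr (_ + _); rewrite [RHS](bigID (fun j => j != s)) /=.
rewrite [X in _ = _ + X]big1 ?addr0 => [|j /andP[_ /negbNE /eqP ->]]; last ring.
apply: eq_bigr => j /andP[_ js]; rewrite /crossing.
by field; apply: b_neq; rewrite eq_sym.
Qed.

(** If [s] were alone in [I], its gap would carry all of [rho]. *)
Lemma toggle_neq0 I s x : I != set0 -> gap I s x = 0 -> toggle I s != set0.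
Proof.
move=> I0 gs; apply/eqP => /setP toggle0.
have I1 : I = [set s].
  apply/setP => j; move: (toggle0 j); rewrite in_toggle !inE.
  by case: eqVneq => //= _ /negbFE.
by move: (sum_gap x I0); rewrite {1}I1 big_set1 gs mulr0; move: rho_gt0; lra.
Qed.

Lemma toggle_gap I s x : I != set0 -> toggle I s != set0 ->
  weight (toggle I s) * gap (toggle I s) s x = weight I * gap I s x.
Proof. by move=> I0 J0; rewrite !weight_gap // sum_toggle // subrr mulr0. Qed.

Lemma toggle_slope I s : I != set0 -> toggle I s != set0 ->
  weight (toggle I s) * (slope (toggle I s) - b s) = weight I * (slope I - b s).
Proof. by move=> I0 J0; rewrite !weight_slope // sum_toggle // subrr mulr0. Qed.

(** The affine pieces for [I] and for [toggle I s] both pass through the point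
    where the path meets the line of [s]. *)
Lemma toggle_gamma I s x : I != set0 -> gap I s x = 0 ->
  gamma (toggle I s) x = gamma I x.
Proof.
move=> I0 gs; have J0 := toggle_neq0 I0 gs; have w_gt0 := weight_gt0 J0.
have : gap (toggle I s) s x = 0.
  apply/eqP; move/eqP: (toggle_gap x I0 J0).
  by rewrite gs mulr0 mulf_eq0 gt_eqF.
by move: gs; rewrite /gap; lra.
Qed.

Lemma sector_of_no_zero prev lo I : active_before prev I -> (lo < prev)%E ->
  (forall (x : R) s, (lo < x%:E)%E -> (x%:E < prev)%E -> gap I s x <> 0) ->
  sector I lo prev.
Proof.
move=> [I0 near] lo_prev no_zero s; have [l l_prev pos] := near s.
have [y []] : exists y : R, (Order.max lo l%:E < y%:E)%E /\ (y%:E < prev)%E.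
  by apply: real_between; rewrite gt_max lo_prev.
rewrite gt_max lte_fin => /andP[lo_y l_y] y_prev x.
have gE z : side I s * gap I s z =
    side I s * (slope I - b s) * z + side I s * (intercept I + c s).
  by rewrite gapE; ring.
rewrite gE; apply: (affine_sign lo_y y_prev); first by rewrite -gE pos.
move=> z lo_z z_prev; rewrite -gE => /eqP.
by rewrite mulf_eq0 signr_eq0 /= => /eqP; apply: no_zero.
Qed.

(** The gap of [s] vanishes at the lower end of the sector and has the sign
    [side I s] above it. *)
Lemma sector_zero_slope I s (x : R) prev : (x%:E < prev)%E ->
  sector I x%:E prev -> gap I s x = 0 -> 0 < side I s * (slope I - b s).
Proof.
move=> x_prev sec gs; have [y [xy y_prev]] := real_between x_prev.
have [_ /(_ xy y_prev)] := sec s y; rewrite lte_fin in xy.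
have -> : gap I s y = (slope I - b s) * (y - x).
  by rewrite -[LHS]subr0 -gs !gapE; ring.
by rewrite mulrA pmulr_lgt0 // subr_gt0.
Qed.

(** The gap of [s] is affine and vanishes at [x], so it changes sign there, and
    by [toggle_gap] this sign is the same for [I] and [toggle I s].  Every other
    gap is nonzero at [x] by [zero_unique] and takes the same value at [x] for
    both sets, so that it keeps its sign nearby. *)
Lemma active_before_toggle I s (x : R) prev : I != set0 -> (x%:E < prev)%E ->
  sector I x%:E prev -> gap I s x = 0 -> active_before x%:E (toggle I s).
Proof.
move=> I0 x_prev sec gs; have J0 := toggle_neq0 I0 gs; split=> // j.
have [->|js] := eqVneq j s.
  exists (x - 1); first by rewrite lte_fin; lra.
  move=> y _; rewrite lte_fin => yx.
  rewrite -(pmulr_rgt0 _ (weight_gt0 J0)) mulrCA toggle_gap // side_toggle.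
  have gy : gap I s y = (slope I - b s) * (y - x).
    by rewrite -[LHS]subr0 -gs !gapE; ring.
  have -> : - side I s * (weight I * gap I s y) =
      weight I * (side I s * (slope I - b s)) * (x - y) by rewrite gy; ring.
  apply: mulr_gt0; last by rewrite subr_gt0.
  by apply: mulr_gt0; [exact: weight_gt0 | exact: sector_zero_slope sec gs].
have gx : 0 < side I j * gap I j x.
  rewrite lt_neqAle (sec j x).1 ?lexx ?(ltW x_prev) // andbT eq_sym.
  rewrite mulf_eq0 signr_eq0 /=; apply: contra js => /eqP gj.
  by apply/eqP; apply: zero_unique gj gs.
have gE z : side (toggle I s) j * gap (toggle I s) j z =
    side I j * (slope (toggle I s) - b j) * z
    + side I j * (intercept (toggle I s) + c j).
  by rewrite side_toggle_neq // gapE; ring.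
have [|lo lo_x pos] := @affine_pos_left _
    (side I j * (slope (toggle I s) - b j))
    (side I j * (intercept (toggle I s) + c j)) x.
  by rewrite -gE side_toggle_neq // /gap toggle_gamma.
by exists lo; rewrite ?lte_fin // => y lo_y; rewrite lte_fin gE; apply: pos.
Qed.

(** Far to the right the line of smallest slope is the lowest one, and the path
    runs above it at the constant distance [rho / a i]. *)
Lemma active_before_start i : (forall j, b i <= b j) ->
  active_before +oo%E [set i].
Proof.
move=> i_min; have [reg1 _ _] := reg.
have i0 : [set i] != set0 by apply/set0Pn; exists i; rewrite inE.
have gi x : a i * gap [set i] i x = rho by rewrite -(sum_gap x i0) big_set1.
split=> // s; have [->|si] := eqVneq s i.
  exists 0; rewrite ?ltry // => x _ _.
  by rewrite side_in ?inE // mul1r -(pmulr_rgt0 _ (a_gt0 i)) gi.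
have b_is : b i - b s < 0.
  by rewrite subr_lt0 lt_neqAle i_min andbT reg1 // eq_sym.
have slope1 : slope [set i] = b i.
  by rewrite /Defs.slope !big_set1 mulrAC divff ?mul1r ?gt_eqF.
exists (- (intercept [set i] + c s) / (b i - b s)); first by rewrite ltry.
move=> x x_gt _; rewrite side_notin ?inE // gapE slope1.
by move: x_gt; rewrite ltr_ndivrMr //; lra.
Qed.

(** Induction along a run which also provides the invariant and the fact that
    the current set is correct down to the next breakpoint. *)
Lemma runA_path_ind (P : \bar R -> {set 'I_S} -> segments R -> Prop) :
  (forall prev I,
     active_before prev I -> (-oo < prev)%E -> sector I -oo%E prev ->
     P prev I [:: (-oo%E, slope I, intercept I)]) ->
  (forall prev I (alpha : R) s out,
     active_before prev I -> (alpha%:E < prev)%E -> sector I alpha%:E prev ->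
     zero_at I s alpha -> active_before alpha%:E (toggle I s) ->
     P alpha%:E (toggle I s) out ->
     P prev I ((alpha%:E, slope I, intercept I) :: out)) ->
  forall prev I out, active_before prev I -> runA a b c rho prev I out ->
    P prev I out.
Proof.
move=> stop step prev I out act run; elim: run act => {prev I out}.
- move=> prev I no_zero act.
  have prevNy : (-oo < prev)%E.
    case: act => I0 near; have /set0Pn[s _] := I0.
    by have [lo lo_prev _] := near s; apply: le_lt_trans lo_prev; rewrite leNye.
  apply: stop => //.
  by apply: sector_of_no_zero => // x s _; apply: no_zero.
- move=> prev I alpha s out alpha_prev zero largest _ IH act.
  have sec : sector I alpha%:E prev.
    apply: sector_of_no_zero => // x j alpha_x x_prev zero_j.
    by move: (largest x j x_prev zero_j); rewrite leNgt -lte_fin alpha_x.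
  have act' : active_before alpha%:E (toggle I s).
    by apply: active_before_toggle sec zero => //; case: act.
  by apply: step (IH act').
Qed.

(** * The solution path *)

Lemma pos_form_lt x g g' : g < g' -> 0 < pos_form a b c x g ->
  pos_form a b c x g < pos_form a b c x g'.
Proof.
move=> gg' pos.
have le_max s :
    Num.max 0 (- b s * x + g + c s) <= Num.max 0 (- b s * x + g' + c s).
  by rewrite ge_max !le_max lexx /=; apply/orP; right; lra.
have [s s_pos] : exists s, 0 < - b s * x + g + c s.
  apply/existsP; apply: contraLR pos; rewrite negb_exists => /forallP npos.
  rewrite -leNgt /pos_form big1 // => s _.
  by move: (npos s); rewrite -leNgt => /max_idPl ->; rewrite mulr0.
rewrite /pos_form (bigD1 s) // [ltRHS](bigD1 s) //=.
apply: ltr_leD; last by apply: ler_sum => j _; rewrite ler_wpM2l // ltW.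
by rewrite ltr_pM2l // !(max_idPr _); lra.
Qed.

Lemma pos_form_inj x g g' :
  pos_form a b c x g = rho -> pos_form a b c x g' = rho -> g = g'.
Proof.
by move=> gE g'E; case: (ltgtP g g') => // /(@pos_form_lt x);
  rewrite gE g'E ltxx => /(_ rho_gt0).
Qed.

Lemma sector_solution I lo hi (x : R) : I != set0 -> sector I lo hi ->
  (lo <= x%:E)%E -> (x%:E <= hi)%E ->
  pos_form a b c x (slope I * x + intercept I) = rho.
Proof.
move=> I0 sec lo_x x_hi.
by rewrite -gamma_segE (pos_form_sector _ sec) // sum_gap.
Qed.

(** The upper end of the segment at position [t] is the breakpoint stored at
    position [t - 1], and [prev] for the first segment. *)
Lemma runA_solution prev I out : active_before prev I ->
  runA a b c rho prev I out ->
  forall (d : \bar R * R * R) t (x : R), (t < size out)%N ->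
    ((nth d out t).1.1 <= x%:E)%E ->
    (x%:E <= if t is t'.+1 then (nth d out t').1.1 else prev)%E ->
    pos_form a b c x ((nth d out t).1.2 * x + (nth d out t).2) = rho.
Proof.
move: prev I out; apply: runA_path_ind.
- by move=> prev I [I0 _] _ sec d [|t] x //= _; apply: sector_solution sec.
- move=> prev I alpha s out [I0 _] _ sec _ _ IH d [|t] x //= t_lt lo_x x_hi.
    exact: sector_solution lo_x x_hi.
  by apply: IH => //; case: t {t_lt lo_x} x_hi.
Qed.

Lemma runA_solvable prev I out : active_before prev I ->
  runA a b c rho prev I out ->
  forall x : R, (x%:E <= prev)%E -> exists g, pos_form a b c x g = rho.
Proof.
move: prev I out; apply: runA_path_ind.
- move=> prev I [I0 _] _ sec x x_hi; exists (slope I * x + intercept I).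
  by apply: sector_solution sec _ x_hi; rewrite ?leNye.
- move=> prev I alpha s out [I0 _] _ sec _ _ IH x x_hi.
  have [alpha_x|/ltW] := leP alpha%:E x%:E; last exact: IH.
  by exists (slope I * x + intercept I); apply: sector_solution sec _ x_hi.
Qed.

Lemma runA_last prev I out : active_before prev I ->
  runA a b c rho prev I out -> forall d, (last d out).1.1 = -oo%E.
Proof.
move: prev I out; apply: runA_path_ind => //.
by move=> prev I x s out _ _ _ _ _ IH d /=.
Qed.

Lemma runA_functional prev I out : active_before prev I ->
  runA a b c rho prev I out ->
  forall out', runA a b c rho prev I out' -> out' = out.
Proof.
move: prev I out; apply: runA_path_ind.
- move=> prev I act _ sec out' [] // x s out'' x_prev zero.
  by case: (sector_no_zero sec _ x_prev zero); rewrite ltNyr.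
- move=> prev I alpha s out act alpha_prev sec zero _ IH out' [].
    by move=> /(_ alpha s alpha_prev).
  move=> alpha' s' out'' alpha'_prev zero' largest run''.
  have alphaE : alpha' = alpha.
    apply/eqP; rewrite eq_le (largest _ s) // andbT leNgt -lte_fin; apply/negP.
    by move=> /(sector_no_zero sec) /(_ alpha'_prev zero').
  rewrite {}alphaE in zero' run'' *.
  have sE : s' = s by apply: zero_unique zero' zero; case: act.
  by rewrite {}sE in run''; rewrite (IH _ run'').
Qed.

(** * The number of segments *)

(** The number of toggles an index may still undergo: a member can only leave,
    a nonmember can enter (and leave again) only if the slope is below its
    [b s]. *)
Definition potential I : nat :=
  \sum_s if s \in I then 1 else if (slope I < b s)%R then 2 else 0.

(** Concavity of the path.  By [toggle_slope] the new slope lies on the same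
    side of [b s] as the old one; adding a weight with larger [b s], or removing
    one with smaller [b s], raises the average. *)
Lemma slope_increases I s (x : R) prev : I != set0 -> (x%:E < prev)%E ->
  sector I x%:E prev -> gap I s x = 0 -> slope I < slope (toggle I s).
Proof.
move=> I0 x_prev sec gs; have J0 := toggle_neq0 I0 gs.
have w_gt0 := weight_gt0 J0; have as_gt0 := a_gt0 s.
have := toggle_slope I0 J0; have := sector_zero_slope x_prev sec gs.
have [sI|sI] := boolP (s \in I).
- have -> : weight I = weight (toggle I s) + a s.
    by rewrite /weight /toggle sI (big_setD1 s) //= addrC.
  by rewrite side_in //; nra.
- have -> : weight (toggle I s) = weight I + a s.
    by rewrite /weight /toggle (negbTE sI) big_setU1 //= addrC.
  by have := weight_gt0 I0; rewrite side_notin //; nra.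
Qed.

(** The count at [s] drops by one, by the sign of [slope I - b s] at the
    breakpoint; the others do not grow because the slope increases. *)
Lemma potential_decreases I s (x : R) prev : I != set0 -> (x%:E < prev)%E ->
  sector I x%:E prev -> gap I s x = 0 ->
  (potential (toggle I s) < potential I)%N.
Proof.
move=> I0 x_prev sec gs; have incr := slope_increases I0 x_prev sec gs.
have J0 := toggle_neq0 I0 gs.
rewrite /potential (bigD1 s) //= [ltnRHS](bigD1 s) //= -addSn; apply: leq_add.
  rewrite in_toggle eqxx /=; have := sector_zero_slope x_prev sec gs.
  case: (boolP (s \in I)) => sI /=.
    by rewrite side_in // ltNge => sb; case: leP => //; lra.
  by rewrite side_notin // => sb; case: ltP => //; lra.
apply: leq_sum => j /negPf js; rewrite in_toggle js /=; case: ifP => // _.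
by case: ltP => // /(lt_trans incr) ->.
Qed.

Lemma potential_singleton i : (potential [set i] < 2 * S)%N.
Proof.
have -> : (2 * S = 2 + \sum_(s < S | s != i) 2)%N.
  by rewrite -[LHS]mulnC -[in LHS](card_ord S) -sum_nat_const (bigD1 i).
rewrite /potential (bigD1 i) //= inE eqxx /= -addSn.
by rewrite leq_add // leq_sum // => s _; case: ifP => // _; case: ifP.
Qed.

(** * Termination and cost of Algorithm A *)

(** Skipping the indices with [b s] equal to the slope loses no zero: such a
    gap is constant, and nonzero at the origin. *)
Lemma next_zeroTP prev I : I != set0 ->
  let next := next_zeroT b c prev (slope I) (intercept I) in
  largest_zero prev I (enum 'I_S) next.1 /\ (next.2 <= 7 * S)%N.
Proof.
move=> I0.
rewrite -[X in (7 * X)%N]size_enum_ord.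
rewrite /next_zeroT; elim: (enum 'I_S) => [|s r] //=.
set acc := foldr _ _ r; move: acc => [best t] /= [IH t_le].
have skip : (forall y : R, (y%:E < prev)%E -> ~ zero_at I s y) ->
    largest_zero prev I (s :: r) best.
  move=> no_s.
  case: best IH => [[x j] [x_prev zero largest]|none]; first split=> //.
    move=> y k; rewrite inE => /predU1P[-> /no_s //|]; exact: largest.
  move=> y k; rewrite inE => /predU1P[-> /no_s //|]; exact: none.
have [d0|d0] := eqVneq (slope I - b s) 0.
  rewrite /= addn0; split; last by rewrite mulnS; lia.
  apply: skip => y _; rewrite -[zero_at _ _ _]/(gap I s y = 0) => zero.
  by case/eqP: (gap_origin_neq0 s I0); rewrite -zero !gapE d0 !mul0r.
set x0 := - ((intercept I + c s) / (slope I - b s)).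
have zeroE y : zero_at I s y <-> y = x0.
  rewrite -[zero_at _ _ _]/(gap I s y = 0) gapE /x0.
  split=> [|->]; last by field.
  by move/(canRL (addrK _)); rewrite sub0r => /(canRL (mulKf d0)) ->; field.
rewrite !bind_val !bind_cost /= -/x0.
have [x0_prev|prev_x0] := ltP x0%:E prev; last first.
  rewrite /= addn0; split; last by rewrite mulnS; lia.
  by apply: skip => y y_prev /zeroE yE; rewrite yE ltNge prev_x0 in y_prev.
case: best IH {skip} => [[x j] [x_prev zero largest]|none] /=; last first.
  split; last by rewrite mulnS; lia.
  split=> //; first exact/zeroE.
  move=> y k; rewrite inE => /predU1P[-> _ /zeroE -> //|kr y_prev zero].
  by case: (none y k).
split; last by rewrite mulnS; lia.
case: ltP => [x_x0|x0_x]; split=> //; try exact/zeroE.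
  move=> y k; rewrite inE => /predU1P[-> _ /zeroE -> //|kr y_prev zero_k].
  by apply: le_trans (ltW x_x0); apply: largest zero_k.
move=> y k; rewrite inE => /predU1P[-> _ /zeroE -> //|]; exact: largest.
Qed.

(** The potential bounds the number of iterations, so any fuel [N]
    above it is enough. *)
Lemma runA_complete N prev I : active_before prev I -> (potential I < N)%N ->
  exists out t, [/\ runA a b c rho prev I out,
    loopA a b c rho N prev I = (Some out, t),
    (size out <= (potential I).+1)%N & (t <= 16 * S * size out)%N].
Proof.
elim: N prev I => [//|N IH] prev I act pot_N; have [I0 _] := act.
have S_gt0 := set_neq0_gt0 I0.
(* Per iteration: (3 * S + 1) + (3 * S + 2) + 7 * S <= 16 * S, as 0 < S. *)
have [] := next_zeroTP prev I0; rewrite loopA_step.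
move: (slopeT_cost I) (interceptT_cost I).
case: (slopeT a b I) => m tm; case: (interceptT a c rho I) => v tv.
case: (next_zeroT _ _ _ _ _) => [[[x s]|] t] /= tm_le tv_le next t_le;
  last first.
  exists [:: (-oo%E, slope I, intercept I)]; eexists.
  split=> //; last by rewrite /=; lia.
  by apply: runA_stop => y s; apply: next; rewrite mem_enum.
have [x_prev zero largest] := next.
have sec : sector I x%:E prev.
  apply: sector_of_no_zero => // y j x_y y_prev zero_j.
  move: (largest y j (mem_enum _ _) y_prev zero_j).
  by rewrite leNgt -lte_fin x_y.
have pot_lt := potential_decreases I0 x_prev sec zero.
have act' := active_before_toggle I0 x_prev sec zero.
have [|out [t' [run' -> out_le t'_le]]] := IH _ _ act'; first by lia.
exists ((x%:E, slope I, intercept I) :: out); eexists; split=> //.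
- by apply: runA_step run' => // y j; apply: largest; rewrite mem_enum.
- by apply: leq_trans pot_lt.
- by rewrite /= mulnS; lia.
Qed.

(** * The left-hand side of (E2) along the path *)

(** Continuity at a breakpoint. *)
Lemma toggle_affine w I s x : I != set0 -> gap I s x = 0 ->
  coefA w (toggle I s) * x + coefB w (toggle I s) = coefA w I * x + coefB w I.
Proof.
move=> I0 gs; rewrite -!sum_gap_affine.
have -> : \sum_(j in toggle I s) w j * gap (toggle I s) j x =
          \sum_(j in toggle I s) w j * gap I j x.
  by apply: eq_bigr => j _; rewrite /gap toggle_gamma.
by rewrite sum_toggle // gs mulr0.
Qed.

Lemma coefA_singleton w i : coefA w [set i] = 0.
Proof.
rewrite /coefA big_set1 /Defs.slope !big_set1 mulrAC divff ?gt_eqF //.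
by rewrite mul1r subrr mulr0.
Qed.

Lemma coefB_singleton w i : coefB w [set i] = w i * (rho / a i).
Proof.
have a0 : a i != 0 by rewrite gt_eqF.
by rewrite /coefB big_set1 /Defs.intercept !big_set1; field.
Qed.

End SolutionPath.

(** * Correctness and cost of Algorithm B *)

Section AlgorithmB.
Variable R : realType.

(** The acceptance test of Algorithm B.  When [hi] is [+oo] the value at [hi] is
    infinite, with the sign of [A], so that only the bound at [lo] is tested. *)
Lemma affine_solution (A B y lo : R) (hi : \bar R) : A != 0 -> (lo%:E < hi)%E ->
  (Order.min (A%:E * lo%:E + B%:E) (A%:E * hi + B%:E) <= y%:E)%E ->
  (y%:E <= Order.max (A%:E * lo%:E + B%:E) (A%:E * hi + B%:E))%E ->
  lo <= (y - B) / A /\ (((y - B) / A)%:E <= hi)%E.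
Proof.
move=> A0; have : A * ((y - B) / A) + B = y by field.
move: ((y - B) / A) => z zE lo_hi; rewrite ge_min le_max.
have {A0} A_sign : A < 0 \/ 0 < A by apply/orP; rewrite -neq_lt.
case: hi lo_hi => [hi| |] //; rewrite ?lte_fin => lo_hi.
  rewrite -!EFinM -!EFinD !lee_fin.
  by case: A_sign => A_sign /orP[] ? /orP[] ?; split; nra.
rewrite leey -!EFinM -!EFinD !lee_fin mulry.
case: A_sign => A_sign.
- rewrite ltr0_sg // mulN1e addNye leeNy_eq orbF => _ /= y_le.
  by split=> //; nra.
- rewrite gtr0_sg // mul1e addye // leye_eq orbF => le_y _.
  by split=> //; nra.
Qed.

Variables (S k : nat) (sigma pbar b : 'I_S -> R) (beta : R).
Variable pick : \bar R -> \bar R -> timed R.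
Hypothesis sigma_gt0 : forall s, 0 < sigma s.
Hypothesis pbar_simplex : simplex pbar.
Hypothesis beta_lt : beta < \sum_s b s * pbar s.
Hypothesis reg : regular (inv_var sigma) b (shift sigma pbar) 2.
Hypothesis pickP : interior_rule k pick.
Implicit Types (I : {set 'I_S}) (prev : \bar R).

Local Notation a := (inv_var sigma).
Local Notation c := (shift sigma pbar).
Local Notation w := (fun s => b s * inv_var sigma s).
Local Notation slope := (slope a b).
Local Notation intercept := (intercept a c 2).
Local Notation A_ := (coefA a b w).
Local Notation B_ := (coefB a c 2 w).
Local Notation sector := (sector a b c 2).
Local Notation active_before := (active_before a b c 2).

Lemma inv_var_gt0 s : 0 < a s.
Proof. by rewrite invr_gt0 exprn_gt0. Qed.

Lemma inv_var_shift s : a s * c s = 2 * pbar s.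
Proof.
by rewrite /inv_var /shift; field; rewrite gt_eqF.
Qed.

(** At the origin the positive parts reduce to the shifts [c s], and the weights
    [a s] cancel the variances in them. *)
Lemma pos_form_origin (u : 'I_S -> R) :
  pos_form (fun s => u s * a s) b c 0 0 = 2 * \sum_s u s * pbar s.
Proof.
have [pbar_ge0 _] := pbar_simplex.
rewrite mulr_sumr; apply: eq_bigr => s _; rewrite mulr0 !add0r (max_idPr _).
  by rewrite -mulrA inv_var_shift; ring.
by rewrite !mulr_ge0 ?ler0n ?exprn_ge0 // ltW.
Qed.

(** The path passes through the origin since [pbar] sums to 1. *)
Lemma E1_origin : E1 sigma pbar b 0 0.
Proof.
have [_ pbar1] := pbar_simplex; rewrite /E1.
have <- : pos_form (fun s => 1 * a s) b c 0 0 = 2.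
  rewrite pos_form_origin; under eq_bigr do rewrite mul1r.
  by rewrite pbar1 mulr1.
by apply: eq_bigr => s _; rewrite mul1r.
Qed.

(** [B_ I] is the left-hand side of (E2) at [alpha = 0]. *)
Lemma target_lt_coefB I lo hi : I != set0 -> sector I lo hi ->
  (lo <= 0%:E)%E -> (0%:E <= hi)%E -> 2 * beta < B_ I.
Proof.
move=> I0 sec lo0 hi0.
have := pos_form_affine w sec lo0 hi0.
have := sector_solution inv_var_gt0 I0 sec lo0 hi0.
have two_gt0 : 0 < 2 :> R by rewrite ltr0n.
move=> /(pos_form_inj inv_var_gt0 two_gt0) /(_ E1_origin) ->.
by rewrite pos_form_origin mulr0 add0r => <-; rewrite ltr_pM2l.
Qed.

(** One interior point reveals the whole active set, as no gap changes sign
    inside a sector. *)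
Lemma activeT_val I lo hi (x : R) : sector I lo hi ->
  (lo < x%:E)%E -> (x%:E < hi)%E ->
  (activeT sigma pbar b (slope I) (intercept I) x).1 = enum I.
Proof.
move=> sec lo_x x_hi; rewrite /activeT filterT_val enumT /enum_mem.
apply: eq_filter => s /=.
have -> : 2 * (sigma s * sigma s) * pbar s = c s by rewrite /shift expr2.
rewrite -gapE; have [_ /(_ lo_x x_hi)] := sec s x.
have [sI|sI] := boolP (s \in I); first by rewrite side_in // mul1r.
by rewrite side_notin // mulN1r oppr_gt0 => /lt_gtF.
Qed.

Lemma coefAT_val I : (coefAT sigma b (slope I) (enum I)).1 = A_ I.
Proof. by rewrite /coefAT sumT_val /= big_enum. Qed.

Lemma coefBT_val I : (coefBT sigma pbar b (intercept I) (enum I)).1 = B_ I.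
Proof.
rewrite /coefBT sumT_val /= big_enum; apply: eq_bigr => s _.
by rewrite /shift expr2.
Qed.

Lemma activeT_cost m v x : ((activeT sigma pbar b m v x).2 <= 8 * S)%N.
Proof.
by rewrite mulnC -[X in (X * 8)%N]size_enum_ord; apply: filterT_cost.
Qed.

Lemma coefAT_cost I m : ((coefAT sigma b m (enum I)).2 <= 5 * S)%N.
Proof.
have card_le := size_enum_set I.
by apply: leq_trans (sumT_cost _ (k := 4) _) _ => //; rewrite mulnC leq_mul2l.
Qed.

Lemma coefBT_cost I v : ((coefBT sigma pbar b v (enum I)).2 <= 8 * S)%N.
Proof.
have card_le := size_enum_set I.
by apply: leq_trans (sumT_cost _ (k := 7) _) _ => //; rewrite mulnC leq_mul2l.
Qed.

(** The search succeeds before it passes [0], so the iterations that matter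
    have [0 < prev] and are not skipped. *)
Lemma loopB_step prev alpha m v out : (0%:E < prev)%E ->
  let x := pick alpha prev in
  let act := activeT sigma pbar b m v x.1 in
  let A := coefAT sigma b m act.1 in
  let B := coefBT sigma pbar b v act.1 in
  let lo := Order.max 0%:E alpha in
  let F y := (A.1%:E * y + B.1%:E)%E in
  let t := (x.2 + act.2 + A.2 + B.2 + 11)%N in
  let rest := loopB sigma pbar b beta pick alpha out in
  loopB sigma pbar b beta pick prev ((alpha, m, v) :: out) =
  if (Order.min (F lo) (F prev) <= (2 * beta)%:E)%E &&
     ((2 * beta)%:E <= Order.max (F lo) (F prev))%E then
    let y := if A.1 == 0 then fine lo else (2 * beta - B.1) / A.1 in
    (Some (y, m * y + v), (t + (A.1 != 0%R) * 2 + 3)%N)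
  else (rest.1, t + rest.2)%N.
Proof.
move=> prev_gt0 x act A B lo F t rest.
rewrite [LHS]surjective_pairing.
cbn [loopB bind op ret affineT fst snd].
rewrite leNgt prev_gt0; cbn [negb bind op ret affineT fst snd].
rewrite -/x -/act -/A -/B -/lo -/(F lo) -/(F prev).
case: ifP => _; cbn [bind op ret affineT fst snd]; last first.
  congr (_, _); rewrite -/rest /t.
  by move: x.2 act.2 A.2 B.2 rest.2 => *; lia.
case: (A.1 == 0); cbn [bind op ret affineT fst snd]; congr (_, _); rewrite /t.
  by move: x.2 act.2 A.2 B.2 => *; lia.
by move: x.2 act.2 A.2 B.2 => *; lia.
Qed.

Definition solves (y g : R) : Prop :=
  [/\ 0 <= y, E1 sigma pbar b y g & E2 sigma pbar b beta y g].

(** A rejected segment has its value at [lo = max 0 alpha] strictly below the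
    target.  That [lo] cannot be [0], where the value exceeds the target, so
    that it is the next breakpoint [alpha], and the invariant holds there. *)
Lemma loopB_segment prev alpha I out :
  active_before prev I -> (alpha < prev)%E -> sector I alpha prev ->
  (0%:E < prev)%E -> ((A_ I)%:E * prev + (B_ I)%:E <= (2 * beta)%:E)%E ->
  let run := loopB sigma pbar b beta pick prev in
  let whole := run ((alpha, slope I, intercept I) :: out) in
  let rest := loopB sigma pbar b beta pick alpha out in
  (exists y g t,
     [/\ whole = (Some (y, g), t), solves y g & (t <= (37 + k) * S)%N])
  \/ [/\ (0%:E < alpha)%E, ((A_ I)%:E * alpha + (B_ I)%:E <= (2 * beta)%:E)%E &
         exists2 t, (t <= (37 + k) * S)%N & whole = (rest.1, t + rest.2)%N].
Proof.
move=> [I0 _] alpha_prev sec prev_gt0 prev_le run whole rest.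
have S_gt0 := set_neq0_gt0 I0.
have [alpha_x x_prev _ tx] := pickP alpha_prev prev_gt0.
rewrite /whole /run loopB_step // (activeT_val sec) //.
rewrite coefAT_val coefBT_val -/rest.
set t0 := ((pick alpha prev).2 +
    (activeT sigma pbar b (slope I) (intercept I) (pick alpha prev).1).2 +
    (coefAT sigma b (slope I) (enum I)).2 +
    (coefBT sigma pbar b (intercept I) (enum I)).2)%N.
(* Per index: 8 + 5 + 8 operations for the active set and the two sums. *)
have t0_le : (t0 + 16 <= (37 + k) * S)%N.
  have := activeT_cost (slope I) (intercept I) (pick alpha prev).1.
  have := coefAT_cost I (slope I); have := coefBT_cost I (intercept I).
  have kS : (k <= k * S)%N by rewrite leq_pmulr.
  rewrite {}/t0; move: tx.
  move: (pick _ _).2 (activeT _ _ _ _ _ _).2 (coefAT _ _ _ _).2.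
  by move: (coefBT _ _ _ _ _).2 => *; rewrite mulnDl; lia.
clearbody t0.
have [lo [loE lo_ge0 alpha_lo lo_prev]] : exists lo : R,
    [/\ Order.max 0%:E alpha = lo%:E, 0 <= lo,
        (alpha <= lo%:E)%E & (lo%:E < prev)%E].
  case: (leP alpha 0%:E) => [alpha_le|alpha_gt].
    by exists 0.
  exists (fine alpha); have alphaE : (fine alpha)%:E = alpha.
    by apply: fineK; rewrite fin_real // (lt_trans _ alpha_gt) ?ltNyr //
       (lt_le_trans alpha_prev) ?leey.
  by split; rewrite -?lee_fin alphaE // ltW.
rewrite loE; case: ifP => [/andP[ymin_le ymax_ge]|reject].
- left; set y := if _ then _ else _; exists y; do 2 eexists; split; first by [].
    have [y_lo y_prev yE] :
        [/\ lo <= y, (y%:E <= prev)%E & A_ I * y + B_ I = 2 * beta].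
      rewrite /y; case: (eqVneq (A_ I) 0) => [A0|A0] /=; last first.
        have [? ?] := affine_solution A0 lo_prev ymin_le ymax_ge.
        by split=> //; field.
      split=> //; first exact: ltW.
      move: ymin_le ymax_ge.
      rewrite A0 !mul0e !add0e minxx maxxx !lee_fin mul0r add0r.
      by move=> B_le B_ge; apply/eqP; rewrite eq_le B_le B_ge.
    clearbody y; have alpha_y : (alpha <= y%:E)%E.
      by apply: le_trans alpha_lo _; rewrite lee_fin.
    split; first exact: le_trans y_lo.
      exact: (sector_solution inv_var_gt0 I0 sec alpha_y y_prev).
    by rewrite /E2 (pos_form_affine _ sec).
  by apply: leq_trans t0_le; rewrite -!addnA leq_add2l; case: (_ != 0).
- right; have F_lo : (A_ I * lo + B_ I < 2 * beta).
    move: reject; rewrite ge_min prev_le orbT /= => /negbT.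
    by rewrite -ltNge gt_max -EFinM -EFinD lte_fin => /andP[].
  have alpha_gt0 : (0%:E < alpha)%E.
    rewrite ltNge; apply/negP => alpha_le0.
    have lo0 : lo = 0 by move: loE; rewrite (max_idPl alpha_le0) => -[].
    have := target_lt_coefB I0 sec alpha_le0 (ltW prev_gt0).
    by move: F_lo; rewrite lo0 mulr0 add0r => /lt_trans lt /lt; rewrite ltxx.
  split; first exact: alpha_gt0; last first.
    exists (t0 + 11)%N; last by [].
    by apply: leq_trans t0_le; rewrite leq_add2l.
  by rewrite -(max_idPr (ltW alpha_gt0)) loE -EFinM -EFinD lee_fin ltW.
Qed.

(** Rejecting the last segment would need a positive breakpoint [-oo]. *)
Lemma loopB_correct prev I out :
  active_before prev I -> runA a b c 2 prev I out ->
  (0%:E < prev)%E -> ((A_ I)%:E * prev + (B_ I)%:E <= (2 * beta)%:E)%E ->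
  exists y g t, [/\ loopB sigma pbar b beta pick prev out = (Some (y, g), t),
    solves y g & (t <= (37 + k) * S * size out)%N].
Proof.
move: prev I out; apply: (runA_path_ind inv_var_gt0 (ltr0Sn _ 1) reg).
- move=> prev I act prev_Ny sec prev_gt0 prev_le.
  have [[y [g [t [-> ? t_le]]]]|[]] // :=
    loopB_segment [::] act prev_Ny sec prev_gt0 prev_le.
  by exists y, g, t; split=> //; rewrite muln1.
- move=> prev I alpha s out act alpha_prev sec zero act' IH prev_gt0 prev_le.
  have [[y [g [t [-> ? t_le]]]]|] :=
      loopB_segment out act alpha_prev sec prev_gt0 prev_le.
    exists y, g, t; split=> //.
    by apply: leq_trans t_le _; rewrite mulnS leq_addr.
  move=> [alpha_gt0 alpha_le [t t_le ->]].
  have [I0 _] := act.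
  have [] := IH alpha_gt0.
    by rewrite -EFinM -EFinD (toggle_affine inv_var_gt0 (ltr0Sn _ 1) w).
  move=> y [g [t' [-> ? t'_le]]]; exists y, g, (t + t')%N; split=> //.
  by rewrite mulnS leq_add.
Qed.

End AlgorithmB.

Theorem theorem5 (R : realType) (k : nat) :
  exists C : nat,
  forall (S : nat) (sigma pbar b : 'I_S -> R) (beta : R)
         (pick : \bar R -> \bar R -> timed R),
    (forall s, 0 < sigma s) ->
    simplex pbar ->
    (forall s, 0 <= b s) ->
    0 <= beta ->
    (exists2 i, (forall j, b i <= b j) & b i <= beta) ->
    beta < \sum_s b s * pbar s ->
    regular (inv_var sigma) b (shift sigma pbar) 2 ->
    interior_rule k pick ->
    exists (out : segments R) (tA tB : nat) (gamma1 : R -> R)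
           (alpha_star gamma_star : R),
      let T := size out in
      [/\ (* out is the output of Algorithm A *)
          [/\ outputA (inv_var sigma) b (shift sigma pbar) 2 out,
              forall out', outputA (inv_var sigma) b (shift sigma pbar) 2 out' ->
                out' = out
            & exists N, algA (inv_var sigma) b (shift sigma pbar) 2 N
                        = (Some out, tA)],
          (* it describes the solution path of (E1) *)
          [/\ solution_path sigma pbar b gamma1,
              seg_alpha out T = -oo%E
            & forall (t : nat) (alpha : R), (1 <= t <= T)%N ->
                (seg_alpha out t <= alpha%:E)%E ->
                (alpha%:E <= seg_alpha out t.-1)%E ->
                gamma1 alpha = seg_m out t * alpha + seg_v out t],
          (* correctness of Algorithm B *)
          algB sigma pbar b beta pick out
            = (Some (alpha_star, gamma_star), tB) /\
          [/\ 0 <= alpha_star,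
              gamma_star = gamma1 alpha_star,
              E1 sigma pbar b alpha_star gamma_star
            & E2 sigma pbar b beta alpha_star gamma_star]
        & (* running time, without and with that of Algorithm A *)
          [/\ (tB <= C * (S * T))%N,
              (T <= 2 * S)%N,
              (tB <= C * S ^ 2)%N
            & (tA + tB <= C * S ^ 2)%N]].
Proof.
(* With at most [2 * S] segments, Algorithm B costs [(37 + k) * S] per segment;
   Algorithm A costs [16 * S] per segment, and [S] to find the starting index. *)
exists ((37 + k) * 2 + 33)%N => S sigma pbar b beta pick sigma_gt0 simpl _ _.
move=> [i0 i0_min b_le] beta_lt reg pickP.
have two_gt0 : 0 < 2 :> R by rewrite ltr0n.
have a_gt0 := inv_var_gt0 sigma_gt0.
have S_gt0 : (0 < S)%N := leq_ltn_trans (leq0n _) (ltn_ord i0).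
have [i [iE i_min] tmin_le] := min_indexTP b S_gt0.
(* The entries of [b] are distinct, so the starting index is unique. *)
have i0E j : (forall j', b j <= b j') -> j = i.
  move=> j_min; have [reg1 _ _] := reg; apply/eqP; apply: contraT => /reg1.
  by rewrite eq_le j_min i_min.
have act := active_before_start a_gt0 two_gt0 reg i_min.
have [out [t [run loopE T_le t_le]]] :=
  runA_complete a_gt0 two_gt0 reg act (ltnSn _).
have [gamma1 gamma1P] :=
  choice (fun x => runA_solvable a_gt0 two_gt0 reg act run (leey x%:E)).
have path_unique x g : E1 sigma pbar b x g -> g = gamma1 x.
  by move=> gE; apply: (pos_form_inj a_gt0 two_gt0 gE (gamma1P x)).
have [|y [g [tB [algBE [y_ge0 yE1 yE2] tB_le]]]] :=
  loopB_correct sigma_gt0 simpl beta_lt reg pickP act run (ltry 0).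
  rewrite coefA_singleton // mul0e add0e lee_fin coefB_singleton //.
  have -> : b i * inv_var sigma i * (2 / inv_var sigma i) = 2 * b i.
    by field; rewrite gt_eqF.
  by rewrite ler_pM2l // -(i0E _ i0_min).
have T_gt0 : (0 < size out)%N by case: run.
have T_le2S : (size out <= 2 * S)%N.
  by apply: leq_trans T_le _; apply: potential_singleton.
exists out, ((min_indexT b).2 + t)%N, tB, gamma1, y, g.
split.
- split.
  + by exists i.
  + move=> out' [j j_min run']; rewrite (i0E j j_min) in run'.
    exact: (runA_functional a_gt0 two_gt0 reg act run run').
  + exists (potential (inv_var sigma) b [set i]).+1.
    by rewrite /algA [LHS]surjective_pairing bind_val bind_cost iE loopE.
- split.
  + by move=> x g'; split=> [/path_unique|->]; last exact: gamma1P.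
  + rewrite /seg_alpha /seg.
    case: (size out) (nth_last (-oo%E, 0, 0) out) T_gt0 => // n /= -> _.
    exact: (runA_last a_gt0 two_gt0 reg act run).
  + move=> [|n] x //= n_lt lo_x x_hi; apply/esym/path_unique.
    rewrite /seg_m /seg_v /seg /=.
    apply: (runA_solution a_gt0 two_gt0 reg act run) => //.
    by case: n x_hi {n_lt lo_x}.
- by split=> //; split=> //; apply: path_unique.
- split=> //; nia.
Qed.
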